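(* Let $\gamma\in(0,1]$ and let $T$ be a positive integer, with $T\ge2$ if $\gamma=1$. For all $\delta>0$ and $\eta>0$, $$\mathbb{P}\left(\exists\,t\in\{1,\dots,T\}:\ N_t(\gamma^2)>0,\ \frac{R_t(\gamma)-M_t(\gamma)}{\sqrt{N_t(\gamma^2)}}>\delta\right)\le\left\lceil\frac{\log\big(\gamma^{-2T}n_T(\gamma^2)\big)}{\log(1+\eta)}\right\rceil\exp\!\left(-\frac{2\delta^2}{B^2}\Big(1-\frac{\eta^2}{16}\Big)\right).$$
   Context: On a probability space $(\Omega,\mathcal A,\mathbb P)$, let $(X_t)_{t\ge1}$ be independent random variables with $X_t\in[0,B]$ a.s. and $\mu_t=\mathbb E[X_t]$. Let $(\mathcal F_t)_{t\ge0}$ be a filtration with $\sigma(X_1,\dots,X_t)\subset\mathcal F_t$ and $X_s$ independent of $\mathcal F_t$ for $s>t$. Let $(\epsilon_t)_{t\ge1}$ be $\{0,1\}$-valued with $\epsilon_t$ $\mathcal F_{t-1}$-measurable. For $\gamma\in(0,1]$ set $R_t(\gamma)=\sum_{s=1}^t\gamma^{t-s}X_s\epsilon_s$, $M_t(\gamma)=\sum_{s=1}^t\gamma^{t-s}\mu_s\epsilon_s$, $N_t(\gamma)=\sum_{s=1}^t\gamma^{t-s}\epsilon_s$ (so $N_t(\gamma^2)=\sum_{s=1}^t\gamma^{2(t-s)}\epsilon_s$), and $n_t(\gamma)=\sum_{s=1}^t\gamma^{t-s}$ (so $n_T(\gamma^2)=\sum_{s=1}^T\gamma^{2(T-s)}$).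 *)

(* Defs.v *)
From HB Require Import structures.
From mathcomp Require Import all_boot all_order all_algebra.
From mathcomp Require Import all_classical all_reals all_analysis.
Set Implicit Arguments. Unset Strict Implicit. Unset Printing Implicit Defensive.
Import Order.TTheory GRing.Theory Num.Theory.
Local Open Scope classical_set_scope.
Local Open Scope ring_scope.

Section defs.
Context {d : measure_display} {Omega : measurableType d} {R : realType}.

Definition measurable_wrt (G : set (set Omega)) (f : Omega -> R) :=
  forall A : set R, measurable A -> G (f @^-1` A).

Definition filtration (F : nat -> set (set Omega)) :=
  [/\ forall t, sigma_algebra setT (F t),
      forall t, F t `<=` measurable &
      forall s t, (s <= t)%N -> F s `<=` F t].

Definition mutually_independent (P : probability Omega R) (X : nat -> Omega -> R) :=
  forall (I : seq nat), uniq I -> (forall i, i \in I -> (0 < i)%N) ->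
  forall (A : nat -> set R), (forall i, measurable (A i)) ->
  P (\bigcap_(i in [set` I]) (X i @^-1` A i)) = (\prod_(i <- I) P (X i @^-1` A i))%E.

Definition indep_of_sigma (P : probability Omega R) (Y : Omega -> R)
    (G : set (set Omega)) :=
  forall A B, G A -> measurable B ->
  P (A `&` Y @^-1` B) = (P A * P (Y @^-1` B))%E.

Definition Rsum (gamma : R) (X : nat -> Omega -> R) (eps : nat -> Omega -> bool)
    (t : nat) (w : Omega) : R :=
  \sum_(1 <= s < t.+1) gamma ^+ (t - s) * X s w * (eps s w)%:R.

Definition Msum (gamma : R) (mu : nat -> R) (eps : nat -> Omega -> bool)
    (t : nat) (w : Omega) : R :=
  \sum_(1 <= s < t.+1) gamma ^+ (t - s) * mu s * (eps s w)%:R.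

Definition Nsum (gamma : R) (eps : nat -> Omega -> bool) (t : nat) (w : Omega) : R :=
  \sum_(1 <= s < t.+1) gamma ^+ (t - s) * (eps s w)%:R.

End defs.

Definition nsum {R : realType} (gamma : R) (t : nat) : R :=
  \sum_(1 <= s < t.+1) gamma ^+ (t - s).

(* Main.v *)
Require Import Defs.
From HB Require Import structures.
From mathcomp Require Import all_boot all_order all_algebra.
From mathcomp Require Import all_classical all_reals all_analysis.
From mathcomp Require Import measurable_realfun ring lra.
Import Order.TTheory GRing.Theory Num.Theory numFieldNormedType.Exports.
Local Open Scope classical_set_scope.
Local Open Scope ring_scope.

(* Multiplying by gamma^-t turns the ratio into S_t / sqrt V_t, where S_t is the
   sum of gamma^-s (X_s - mu_s) eps_s and V_t that of gamma^(-2s) eps_s. When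
   V_t > 0 it lies between 1 and gamma^(-2T) n_T(gamma^2), a range covered by the
   slices [(1+eta)^k, (1+eta)^(k+1)] with k below the ceiling. On a slice a single
   tilt lambda, optimal at its geometric midpoint, makes the event imply that
   exp (lambda S_t - lambda^2 B^2 V_t / 8) exceeds exp (2 delta^2 / B^2 (1 - eta^2 / 16)).
   By Hoeffding's lemma this process is a supermartingale started at 1, so the
   maximal inequality bounds the probability of each slice. *)

Set Implicit Arguments.
Unset Strict Implicit.

(** * Exponential moments: Hoeffding's lemma and products of independent variables *)

Lemma derive_ge0_le (R : realType) (f df : R -> R) :
  (forall x : R, is_derive x 1 f (df x)) -> (forall x, 0 < x -> 0 <= df x) ->
  forall x, 0 <= x -> f 0 <= f x.
Proof.
move=> dfE df0 x x0.
apply: (@ger0_derive1_ndecry _ f 0) => //.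
- by move=> y; rewrite in_itv/= andbT derive1E => y0; rewrite derive_val df0.
- apply: continuous_subspaceT => y.
  by apply/differentiable_continuous/derivable1_diffP; case: (dfE y).
Qed.

(** The gap between the logarithms, [f x = p x + x^2 / 8 - ln (D x)], vanishes at 0 together with
    its derivative [g]. Its second derivative is [1/4 - u (1 - u) = (1/2 - u)^2], where
    [u = p e^x / D x] is the success probability after tilting. Two uses of monotonicity give
    [g >= 0] and then [f >= 0]. *)
Lemma bernoulli_mgf_le (R : realType) (p h : R) : 0 <= p <= 1 -> 0 <= h ->
  1 - p + p * expR h <= expR (p * h + h ^+ 2 / 8).
Proof.
move=> /andP[p0 p1] h0.
pose D (x : R) : R := 1 - p + p * expR x.
have D0 x : 0 < D x.
  have e0 := expR_gt0 x; rewrite /D; have [p1'|p1'] := ltP p 1.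
    by rewrite ltr_pwDl ?subr_gt0// mulr_ge0// ltW.
  have -> : p = 1 by apply/eqP; rewrite eq_le p1 p1'.
  by rewrite subrr add0r mul1r.
have dD (x : R) : is_derive x 1 D (p * expR x).
  rewrite /D; apply: is_derive_eq; rewrite /GRing.scale/=; ring.
pose g (x : R) : R := p + x / 4 - p * expR x * (D x)^-1.
have dg (x : R) : is_derive x 1 g ((1 / 2 - p * expR x / D x) ^+ 2).
  have DV : is_derive x 1 (fun y => (D y)^-1) (- D x ^- 2 *: (p * expR x)).
    by apply: is_deriveV; rewrite gt_eqF.
  rewrite /g; apply: is_derive_eq; rewrite /GRing.scale/=.
  by field; rewrite gt_eqF.
have g0 x : 0 < x -> 0 <= g x.
  move=> x0; have := @derive_ge0_le _ g _ dg (fun y _ => sqr_ge0 _) x (ltW x0).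
  by rewrite {1}/g /D expR0 mulr1 subrK invr1 mul0r addr0 mulr1 subrr.
pose f (x : R) : R := p * x + x ^+ 2 / 8 - ln (D x).
have df (x : R) : is_derive x 1 f (g x).
  have dl : is_derive x 1 (fun y => ln (D y)) ((p * expR x) * (D x)^-1).
    have := @is_derive1_comp _ (@ln R) D x _ _ (is_derive1_ln (D0 x)) (dD x).
    by rewrite mulrC.
  rewrite /f /g; apply: is_derive_eq; rewrite /GRing.scale/=.
  by field; rewrite gt_eqF.
have := @derive_ge0_le _ f g df g0 h h0.
rewrite {1}/f /D expR0 mulr1 subrK ln1 mulr0 expr0n mul0r addr0 subr0.
rewrite subr_ge0 => H.
rewrite -[leLHS]lnK ?posrE ?ler_expR //; exact: D0.
Qed.

(** Independence says that the joint law agrees with the product of the marginal laws on rectangles,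
    hence everywhere; Tonelli then splits the integral. *)
Lemma indep_integralM (d : measure_display) (Omega : measurableType d)
    (R : realType) (P : probability Omega R) (W Y : Omega -> R) :
  measurable_fun setT W -> measurable_fun setT Y ->
  (forall w, 0 <= W w) -> (forall w, 0 <= Y w) ->
  (forall A B, measurable A -> measurable B ->
    P ((W @^-1` A) `&` (Y @^-1` B)) = (P (W @^-1` A) * P (Y @^-1` B))%E) ->
  (\int[P]_w (W w * Y w)%:E = \int[P]_w (W w)%:E * \int[P]_w (Y w)%:E)%E.
Proof.
move=> mW mY W0 Y0 WY.
pose X := fun w => (W w, Y w).
have mX : measurable_fun setT X by exact: measurable_fun_pair.
pose W' : {mfun Omega >-> R} := HB.pack W (isMeasurableFun.Build _ _ _ _ _ mW).
pose Y' : {mfun Omega >-> R} := HB.pack Y (isMeasurableFun.Build _ _ _ _ _ mY).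
pose X' : {mfun Omega >-> (R * R)%type} :=
  HB.pack X (isMeasurableFun.Build _ _ _ _ _ mX).
have XE : forall A, measurable A ->
    (distribution P W' \x distribution P Y')%E A = distribution P X' A.
  by apply: product_measure_unique => A B mA mB; exact: WY.
(* Absolute values make the integrands nonnegative on all of [R], as Tonelli requires; they change
   nothing on the values of [W] and [Y]. *)
pose n : R -> \bar R := EFin \o (@Num.norm R R).
pose g : R * R -> R := ((@Num.norm R R) \o fst) \* ((@Num.norm R R) \o snd).
pose f : R * R -> \bar R := EFin \o g.
have mf : measurable_fun setT f.
  by apply/measurable_EFinP; apply: measurable_funM; apply: measurableT_comp.
have f0 z : (0 <= f z)%E by rewrite lee_fin mulr_ge0 //= normr_ge0.
have n0 x : (0 <= n x)%E by rewrite lee_fin normr_ge0.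
have mn : measurable_fun setT n.
  by apply/measurable_EFinP; exact: normr_measurable.
transitivity (\int[distribution P X']_z f z)%E.
  rewrite ge0_integral_distribution//; apply: eq_integral => w _ /=.
  by rewrite /f/g/= !ger0_norm.
transitivity (\int[distribution P W' \x distribution P Y']_z f z)%E.
  apply: eq_measure_integral => A mA _; exact/esym/XE.
rewrite fubini_tonelli1// /fubini_F.
transitivity (\int[distribution P W']_x (n x * \int[distribution P Y']_y n y))%E.
  apply: eq_integral => x _; rewrite -ge0_integralZl//.
rewrite ge0_integralZr//; last by apply: integral_ge0 => y _; rewrite lee_fin.
rewrite !ge0_integral_distribution//.
by congr (_ * _)%E; apply: eq_integral => w _; rewrite /n/= ger0_norm.
Qed.

(** Convexity of [expR] between the endpoints [0] and [B], with weight [x / B] on [B]. *)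
Lemma expR_le_chord (R : realType) (a B x : R) : 0 < B -> 0 <= x <= B ->
  expR (a * x) <= 1 + (expR (a * B) - 1) / B * x.
Proof.
move=> B0 /andP[x0 xB].
have t01 : 0 <= x / B <= 1 by rewrite divr_ge0 ?ler_pdivrMr ?mul1r// ltW.
have := convex_expR (Itv01 (proj1 (andP t01)) (proj2 (andP t01))) (a * B) 0.
rewrite !convRE /= mulr0 addr0 /unstable.onem expR0 mulr1.
have -> : x / B * (a * B) = a * x by field; rewrite gt_eqF.
move=> /le_trans; apply.
by rewrite le_eqVlt; apply/orP; left; apply/eqP; ring.
Qed.

Lemma ae_eq_clip (d : measure_display) (Omega : measurableType d)
    (R : realType) (P : probability Omega R) (B : R) (X : Omega -> R) :
  {ae P, forall w, 0 <= X w <= B} ->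
  {ae P, forall w, X w = Num.max 0 (Num.min B (X w))}.
Proof.
apply: filterS => w /andP[X0 XB].
by rewrite (min_idPr XB) (max_idPr X0).
Qed.

(** The chord bound is affine in [X], so its integral depends on the mean only. This reduces the
    claim to a variable on [{0, B}] with success probability [mu / B], where the Bernoulli bound
    applies. *)
Lemma hoeffding_mgf (d : measure_display) (Omega : measurableType d)
    (R : realType) (P : probability Omega R) (B a : R) (X : Omega -> R) :
  0 < B -> 0 <= a -> measurable_fun setT X ->
  {ae P, forall w, 0 <= X w <= B} ->
  (\int[P]_w (expR (a * (X w - fine 'E_P[X]) - (a * B) ^+ 2 / 8))%:E <= 1)%E.
Proof.
move=> B0 a0 mX XB.
(* The bounds on [X] hold only almost surely; the clipped copy satisfies them at every point. *)
pose Y w := Num.max 0 (Num.min B (X w)).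
have YB w : 0 <= Y w <= B.
  by rewrite /Y le_max lexx/= ge_max (ltW B0) ge_min lexx.
have mY : measurable_fun setT Y.
  by apply: measurable_maxr => //; exact: measurable_minr.
have XY : {ae P, forall w, X w = Y w} by exact: ae_eq_clip.
have EXY : ('E_P[X] = \int[P]_w (Y w)%:E)%E.
  rewrite unlock; apply: ae_eq_integral => //; first exact/measurable_EFinP.
    exact/measurable_EFinP.
  by apply: filterS XY => w -> _.
have Y0 w : 0 <= Y w by have /andP[] := YB w.
have EY0 : (0 <= \int[P]_w (Y w)%:E)%E by apply: integral_ge0 => w _; rewrite lee_fin.
have EYB : (\int[P]_w (Y w)%:E <= B%:E)%E.
  apply: (@le_trans _ _ (\int[P]_w B%:E)%E).
    apply: ge0_le_integral => //.
    + by move=> w _; rewrite lee_fin.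
    + exact/measurable_EFinP.
    + by move=> w _; rewrite lee_fin; have /andP[] := YB w.
  by rewrite integral_cst//= probability_setT mule1.
set mu := fine _.
have Emu : (\int[P]_w (Y w)%:E = mu%:E)%E.
  rewrite /mu EXY fineK// fin_numE gt_eqF ?(lt_le_trans _ EY0)//.
  by rewrite lt_eqF ?(le_lt_trans EYB) ?ltry.
have mu0 : 0 <= mu by rewrite -lee_fin -Emu.
have muB : mu <= B by rewrite -lee_fin -Emu.
pose k := expR (- (a * mu) - (a * B) ^+ 2 / 8).
have k0 : 0 <= k by rewrite expR_ge0.
pose c := (expR (a * B) - 1) / B.
have c0 : 0 <= c.
  rewrite divr_ge0 ?(ltW B0)// subr_ge0 -expR0 ler_expR.
  by apply: mulr_ge0 => //; exact: ltW.
have mX' : measurable_fun setT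
    (fun w => expR (a * (X w - mu) - (a * B) ^+ 2 / 8)).
  apply: measurableT_comp => //; apply: measurable_funB => //.
  by apply: measurable_funM => //; exact: measurable_funB.
apply: (@le_trans _ _ (\int[P]_w (k * (1 + c * Y w))%:E)%E).
  apply: ae_ge0_le_integral => //.
  - exact/measurable_EFinP.
  - by move=> w _; rewrite lee_fin mulr_ge0// addr_ge0// mulr_ge0.
  - apply/measurable_EFinP.
    by apply: measurable_funM => //; apply: measurable_funD => //; exact: measurable_funM.
  - apply: filterS XY => w XYw _; rewrite XYw lee_fin.
    have -> : a * (Y w - mu) - (a * B) ^+ 2 / 8 =
      (- (a * mu) - (a * B) ^+ 2 / 8) + a * Y w by ring.
    by rewrite expRD ler_wpM2l// expR_le_chord.
have -> : (\int[P]_w (k * (1 + c * Y w))%:E = k%:E * (1%:E + c%:E * \int[P]_w (Y w)%:E))%E.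
  under eq_integral do rewrite EFinM.
  rewrite ge0_integralZl//; last 2 first.
  - apply/measurable_EFinP.
    by apply: measurable_funD => //; exact: measurable_funM.
  - by move=> w _; rewrite lee_fin addr_ge0// mulr_ge0.
  under eq_integral do rewrite EFinD.
  rewrite ge0_integralD//; last 2 first.
  - by move=> w _; rewrite lee_fin mulr_ge0.
  - by apply/measurable_EFinP; exact: measurable_funM.
  rewrite integral_cst//= probability_setT mule1.
  under eq_integral do rewrite EFinM.
  rewrite ge0_integralZl//.
  - exact/measurable_EFinP.
  - by move=> w _; rewrite lee_fin.
rewrite Emu -!(EFinM, EFinD) lee_fin.
have p01 : 0 <= mu / B <= 1 by rewrite divr_ge0 ?ler_pdivrMr ?mul1r// ltW.
have := @bernoulli_mgf_le _ (mu / B) (a * B) p01 (mulr_ge0 a0 (ltW B0)).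
have -> : mu / B * (a * B) = a * mu by field; rewrite gt_eqF.
have -> : 1 - mu / B + mu / B * expR (a * B) = 1 + c * mu by rewrite /c; ring.
move=> /(ler_wpM2l k0) /le_trans; apply.
by rewrite -expRD -opprD addNr expR0.
Qed.

(** * Adapted processes, predictable products and their maximal inequality *)

Lemma measurable_wrtP (d : measure_display) (Omega : measurableType d)
    (R : realType) (G : set (set Omega)) (f : Omega -> R) :
  sigma_algebra setT G ->
  measurable_wrt G f <-> measurable_fun setT (f : g_sigma_algebraType G -> R).
Proof.
move=> sG; rewrite /measurable_fun measurable_g_measurableTypeE//; split.
  by move=> fG _ A mA; rewrite setTI; exact: fG.
move=> fG A mA; rewrite -[_ @^-1` _]setTI; apply: fG => //.
by case: sG => G0 GC _; rewrite -[[set: _]]setD0; exact: GC.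
Qed.

Section predictable_product.
Context {d : measure_display} {Omega : measurableType d} {R : realType}.
Implicit Types (Y : nat -> Omega -> R) (eps : nat -> Omega -> bool).

Definition predictable (F : nat -> set (set Omega)) eps :=
  forall t, F t [set w | eps t.+1 w].

(** A time that is switched off contributes the factor 1, so stopping the process amounts to
    changing [eps] and leaves [Y] untouched. *)
Definition pprod Y eps (t : nat) (w : Omega) : R :=
  \prod_(1 <= s < t.+1) (if eps s w then Y s w else 1).

Lemma pprod0 Y eps w : pprod Y eps 0 w = 1.
Proof. by rewrite /pprod big_geq. Qed.

Lemma pprodS Y eps t w :
  pprod Y eps t.+1 w = pprod Y eps t w * (if eps t.+1 w then Y t.+1 w else 1).
Proof. by rewrite /pprod big_nat_recr. Qed.

Lemma pprod_ge0 Y eps t w : (forall s w, 0 <= Y s w) -> 0 <= pprod Y eps t w.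
Proof. by move=> Y0; apply: prodr_ge0 => s _; case: ifP. Qed.

Lemma filtration_measurable (F : nat -> set (set Omega)) t (f : Omega -> R) :
  filtration F -> measurable_wrt (F t) f -> measurable_fun setT f.
Proof. by move=> [_ Fm _] fF _ A mA; rewrite setTI; exact/Fm/fF. Qed.

Lemma filtration_le (F : nat -> set (set Omega)) s t (f : Omega -> R) :
  filtration F -> (s <= t)%N -> measurable_wrt (F s) f -> measurable_wrt (F t) f.
Proof. by move=> [_ _ Fh] st fF A mA; exact/(Fh _ _ st)/fF. Qed.

Lemma pprod_adapted (F : nat -> set (set Omega)) Y eps t :
  filtration F -> (forall s, (0 < s)%N -> measurable_wrt (F s) (Y s)) ->
  predictable F eps -> measurable_wrt (F t) (pprod Y eps t).
Proof.
move=> FF FY Feps; have [sF _ Fh] := FF; elim: t => [|t IH].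
  apply/measurable_wrtP => //; rewrite (_ : pprod _ _ _ = cst 1)//.
  by apply/funext => w; rewrite pprod0.
apply/measurable_wrtP => //.
rewrite (_ : pprod Y eps t.+1 = fun w =>
    pprod Y eps t w * (if eps t.+1 w then Y t.+1 w else 1)); last first.
  by apply/funext => w; rewrite pprodS.
apply: measurable_funM.
  by apply/measurable_wrtP => //; exact: (filtration_le FF (leqnSn t)).
apply: measurable_fun_ifT => //.
  apply: (measurable_fun_bool true); rewrite setTI measurable_g_measurableTypeE//.
  exact/(Fh _ _ (leqnSn t))/Feps.
by apply/measurable_wrtP => //; exact: FY.
Qed.

(** The supermartingale step, done without conditional expectations: split the product at time [t]
    into [U], where [eps t.+1] is on, and [V], where it is off. The next factor multiplies [U] only,
    and [U] is measurable for [F t], hence independent of [Y t.+1]. The mean passes from [E V + E U]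
    to [E V + E U * E Y], which is no larger. *)
Lemma integral_pprod_le1 (P : probability Omega R) (F : nat -> set (set Omega))
    Y eps t :
  filtration F ->
  (forall s, (0 < s)%N -> measurable_wrt (F s) (Y s)) ->
  (forall s, indep_of_sigma P (Y s.+1) (F s)) ->
  (forall s w, 0 <= Y s w) ->
  (forall s, (0 < s)%N -> \int[P]_w (Y s w)%:E <= 1)%E ->
  predictable F eps -> (\int[P]_w (pprod Y eps t w)%:E <= 1)%E.
Proof.
move=> FF FY indY Y0 EY Feps; have [sF Fm Fh] := FF.
have mprod n := filtration_measurable FF (pprod_adapted n FF FY Feps).
have mY s : measurable_fun setT (Y s.+1).
  exact/(filtration_measurable FF)/FY.
elim: t => [|t IH].
  under eq_integral do rewrite pprod0.
  by rewrite integral_cst//= probability_setT mule1.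
apply: le_trans IH.
have meps : measurable [set w | eps t.+1 w] by exact/Fm/Feps.
pose e (w : Omega) : R := (eps t.+1 w)%:R.
have eE : e = \1_[set w | eps t.+1 w].
  apply/funext => w; rewrite indicE /e; congr ((nat_of_bool _)%:R).
  by apply/idP/idP; rewrite inE.
have Fe : measurable_wrt (F t) e.
  apply/measurable_wrtP => //; rewrite eE; apply: measurable_indic.
  by rewrite measurable_g_measurableTypeE//; exact: Feps.
have me : measurable_fun setT e by exact: filtration_measurable Fe.
pose U w := pprod Y eps t w * e w.
pose V w := pprod Y eps t w * (1 - e w).
have U0 w : 0 <= U w by rewrite mulr_ge0// ?pprod_ge0// ler0n.
have V0 w : 0 <= V w.
  by rewrite mulr_ge0// ?pprod_ge0// /e; case: (eps _ _); rewrite ?subrr ?subr0.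
have FU : measurable_wrt (F t) U.
  apply/measurable_wrtP => //; apply: measurable_funM.
    by apply/measurable_wrtP => //; exact: pprod_adapted.
  exact/measurable_wrtP.
have mU : measurable_fun setT U by exact: filtration_measurable FU.
have mV : measurable_fun setT V.
  by apply: measurable_funM => //; exact: measurable_funB.
have -> : (\int[P]_w (pprod Y eps t.+1 w)%:E =
    \int[P]_w (V w)%:E + \int[P]_w (U w)%:E * \int[P]_w (Y t.+1 w)%:E)%E.
  rewrite -indep_integralM//; last by move=> A B mA mB; exact: indY (FU _ mA) mB.
  rewrite -ge0_integralD//; last 4 first.
  - by move=> w _; rewrite lee_fin.
  - exact/measurable_EFinP.
  - by move=> w _; rewrite lee_fin mulr_ge0.
  - by apply/measurable_EFinP; exact: measurable_funM.
  apply: eq_integral => w _; rewrite -EFinD pprodS /U /V /e.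
  by case: (eps _ _) => /=; congr (_%:E); ring.
have -> : (\int[P]_w (pprod Y eps t w)%:E =
    \int[P]_w (V w)%:E + \int[P]_w (U w)%:E)%E.
  rewrite -ge0_integralD//; last 4 first.
  - by move=> w _; rewrite lee_fin.
  - exact/measurable_EFinP.
  - by move=> w _; rewrite lee_fin.
  - exact/measurable_EFinP.
  by apply: eq_integral => w _; rewrite -EFinD /U /V; congr (_%:E); ring.
rewrite leeD2l// -[leRHS]mule1 lee_wpmul2l// ?EY//.
by apply: integral_ge0 => w _; rewrite lee_fin.
Qed.

(* The process frozen at its first passage above [c] is again a product of the
   same form, for the predictable switch that turns off after that time. *)
Lemma pprod_maximal (P : probability Omega R) (F : nat -> set (set Omega))
    Y eps T c :
  filtration F ->
  (forall s, (0 < s)%N -> measurable_wrt (F s) (Y s)) ->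
  (forall s, indep_of_sigma P (Y s.+1) (F s)) ->
  (forall s w, 0 <= Y s w) ->
  (forall s, (0 < s)%N -> \int[P]_w (Y s w)%:E <= 1)%E ->
  predictable F eps -> 0 < c ->
  (P (\bigcup_(t in `I_T.+1) [set w | (c <= pprod Y eps t w)%R]) <= (c^-1)%:E)%E.
Proof.
move=> FF FY indY Y0 EY Feps c0; have [sF Fm Fh] := FF.
have Fprod n := pprod_adapted n FF FY Feps.
pose eps' s w := eps s w && [forall u : 'I_s, pprod Y eps u w < c].
have Feps' : predictable F eps'.
  move=> t; rewrite -[F t]measurable_g_measurableTypeE//.
  rewrite (_ : [set w | _] = [set w | eps t.+1 w] `&`
      \bigcap_(u in `I_t.+1) pprod Y eps u @^-1` `]-oo, c[); last first.
    apply/seteqP; split => w /=.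
      move=> /andP[ew /forallP H]; split => // u /= ut.
      by rewrite in_itv/=; exact: (H (Ordinal ut)).
    move=> [ew H]; rewrite /eps' ew; apply/forallP => u.
    by have := H u (ltn_ord u); rewrite /= in_itv.
  apply: measurableI; first by rewrite measurable_g_measurableTypeE//; exact: Feps.
  apply: bigcap_measurableType => u /= ut.
  rewrite measurable_g_measurableTypeE//.
  exact: (filtration_le FF _ (Fprod u)).
have stopE t w : c <= pprod Y eps t w -> (forall u, (u < t)%N -> pprod Y eps u w < c) ->
    forall n, pprod Y eps' n w = pprod Y eps (minn n t) w.
  move=> ct ltc; elim=> [|n IH]; first by rewrite min0n !pprod0.
  rewrite pprodS IH; have [nt|tn] := ltnP n t.
    rewrite (minn_idPl nt) pprodS /eps'.
    case: forallP => [_|[]]; first by rewrite andbT.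
    by move=> u; apply: ltc; exact: leq_trans (ltn_ord u) nt.
  (* After time [t] the switch is off, since the index [t] itself breaks the strict bound. *)
  rewrite (minn_idPr (leqW tn)) /eps'.
  case: forallP => [H|_]; last by rewrite andbF mulr1.
  by have := H (Ordinal (tn : (t < n.+1)%N)); rewrite ltNge ct.
have mprod' : measurable_fun setT (pprod Y eps' T).
  exact: filtration_measurable (pprod_adapted T FF FY Feps').
pose A := [set w | c <= pprod Y eps' T w].
have mA : measurable A.
  rewrite (_ : A = pprod Y eps' T @^-1` `[c, +oo[); last first.
    by apply/seteqP; split => w /=; rewrite in_itv/= andbT.
  by rewrite -[_ @^-1` _]setTI; exact: mprod'.
apply: (@le_trans _ _ (P A)).
  apply: le_measure; rewrite ?inE//.
    apply: bigcup_measurable => t _.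
    rewrite (_ : [set w | _] = pprod Y eps t @^-1` `[c, +oo[); last first.
      by apply/seteqP; split => w /=; rewrite in_itv/= andbT.
    by apply: (Fm t); exact: Fprod.
  move=> w [t /= tT ct]; rewrite /A/=.
  have ex : exists t, c <= pprod Y eps t w by exists t.
  case: (ex_minnP ex) => m cm mmin.
  rewrite (stopE m)//; last by move=> u um; rewrite ltNge; apply/negP => /mmin; rewrite leqNgt um.
  by rewrite (minn_idPr _)// (leq_trans (mmin _ ct)).
rewrite -[leRHS]mule1.
have : (c%:E * P A <= 1)%E.
  apply: (@le_trans _ _ (\int[P]_w (pprod Y eps' T w)%:E)%E); last first.
    exact: (@integral_pprod_le1 P F).
  have -> : P A = (\int[P]_w (\1_A w)%:E)%E by rewrite integral_indic// setIT.
  rewrite -ge0_integralZl//; last 2 first.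
  - by apply/measurable_EFinP; exact: measurable_indic.
  - by rewrite lee_fin ltW.
  apply: ge0_le_integral => //.
  - by move=> w _; rewrite -EFinM lee_fin mulr_ge0// ltW.
  - by apply/measurable_EFinP; exact: measurable_funM.
  - exact/measurable_EFinP.
  - move=> w _; rewrite -EFinM lee_fin indicE; case: (boolP (w \in A)).
      by rewrite inE mulr1.
    by rewrite mulr0 pprod_ge0.
by rewrite lee_pdivlMl.
Qed.

End predictable_product.

(** * Geometric slices and the exponent on one slice *)

Lemma geometric_slice (R : realType) (b V : R) (n : nat) :
  1 <= V -> V <= b ^+ n -> (0 < n)%N ->
  exists2 k, (k < n)%N & b ^+ k <= V <= b ^+ k.+1.
Proof.
move=> V1 + n0; elim: n n0 => // n IH _ Vb.
have [Vn|nV] := leP V (b ^+ n).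
  case: n IH Vb Vn => [_ Vb V1'|n IH _ Vn].
    by exists 0%N => //; rewrite expr0 V1 Vb.
  by have [//|k kn ?] := IH _ Vn; exists k => //; exact: leqW.
by exists n => //; rewrite (ltW nV) Vb.
Qed.

(* With [r = sqrt V / y] the exponent is at least [2 delta^2 / B^2] times
   [2 r - r^2 = 1 - (1 - r)^2]. *)
Lemma tilted_exponent_ge (R : realType) (B delta eta q y S V : R) :
  0 < B -> 0 < delta -> 0 < y -> 1 <= q -> q <= 1 + eta / 4 ->
  (y / q) ^+ 2 <= V <= (y * q) ^+ 2 -> delta < S / Num.sqrt V ->
  2 * delta ^+ 2 / B ^+ 2 * (1 - eta ^+ 2 / 16) <=
  4 * delta / (B ^+ 2 * y) * S - (4 * delta / (B ^+ 2 * y) * B) ^+ 2 / 8 * V.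
Proof.
move=> B0 d0 y0 q1 qeta /andP[Vl Vu].
have q0 : 0 < q by exact: lt_le_trans q1.
have yq0 : 0 < y / q by rewrite divr_gt0.
have V0 : 0 < V by apply: lt_le_trans Vl; rewrite exprn_gt0.
set x := Num.sqrt V; have x0 : 0 < x by rewrite sqrtr_gt0.
have xV : x ^+ 2 = V by rewrite sqr_sqrtr// ltW.
rewrite ltr_pdivlMr// => xS.
have xl : y / q <= x.
  by rewrite -(@ler_pXn2r _ 2)// ?nnegrE ?(ltW yq0, ltW x0)// xV.
have xu : x <= y * q.
  by rewrite -(@ler_pXn2r _ 2)// ?nnegrE ?(ltW x0) ?xV// mulr_ge0 ?ltW.
pose r := x / y; have xE : x = r * y by rewrite /r divfK// gt_eqF.
have r0 : 0 < r by rewrite divr_gt0.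
have rl : 1 <= r * q.
  by rewrite /r mulrAC ler_pdivlMr// mul1r -ler_pdivrMr.
have ru : r <= q by rewrite /r ler_pdivrMr// mulrC.
(* From [1/q <= r <= q] and [1 - 1/q <= q - 1] follows [|1 - r| <= q - 1 <= eta / 4]. *)
have key : 1 - eta ^+ 2 / 16 <= 2 * r - r ^+ 2.
  have : (1 - r) ^+ 2 <= (q - 1) ^+ 2.
    have [r1|r1] := leP r 1; first by rewrite ler_pXn2r// ?nnegrE; nra.
    by rewrite -sqrrN opprB ler_pXn2r// ?nnegrE; nra.
  have : (q - 1) ^+ 2 <= (eta / 4) ^+ 2 by rewrite ler_pXn2r// ?nnegrE; lra.
  by nra.
have k0 : 0 < 4 * delta / (B ^+ 2 * y) by rewrite divr_gt0 ?mulr_gt0 ?exprn_gt0.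
apply: (@le_trans _ _ (2 * delta ^+ 2 / B ^+ 2 * (2 * r - r ^+ 2))).
  by rewrite ler_pM2l// divr_gt0 ?mulr_gt0 ?exprn_gt0.
(* With [S] lowered to [delta * x] the exponent is exactly [2 delta^2 / B^2] times [2 r - r^2]. *)
apply: (@le_trans _ _ (4 * delta / (B ^+ 2 * y) * (delta * x) -
    (4 * delta / (B ^+ 2 * y) * B) ^+ 2 / 8 * V)).
  rewrite -xV xE le_eqVlt; apply/orP; left; apply/eqP.
  by field; rewrite !gt_eqF.
by rewrite lerD2r ler_pM2l// ltW.
Qed.

(** Since [W] and [b] exceed 1, the quotient of logarithms is positive; its ceiling is thus a
    positive natural number and can count the slices. *)
Lemma ceil_log_ge (R : realType) (b W : R) : 1 < b -> 1 < W ->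
  exists2 n, (0 < n)%N & Num.ceil (ln W / ln b) = n%:Z /\ W <= b ^+ n.
Proof.
move=> b1 W1; have lb : 0 < ln b by rewrite ln_gt0.
have W0 : 0 < W by exact: lt_trans W1.
have b0 : 0 < b by exact: lt_trans b1.
have c0 : 0 < Num.ceil (ln W / ln b) by rewrite ceil_gt0 divr_gt0// ln_gt0.
have := ceil_ge (ln W / ln b).
move: c0; case: (Num.ceil _) => // n n0; rewrite ler_pdivrMr// => H.
exists n => //; split => //.
rewrite -ler_ln ?posrE ?exprn_gt0// lnXn//.
by move: H; rewrite mulr_natl.
Qed.

(** * Factoring the discount out of the sums *)

Section discounted_sums.
Context {d : measure_display} {Omega : measurableType d} {R : realType}.
Implicit Types (X : nat -> Omega -> R) (eps : nat -> Omega -> bool) (mu : nat -> R).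

Lemma Rsum_undiscount (gamma : R) X mu eps t w : gamma != 0 ->
  Rsum gamma X eps t w - Msum gamma mu eps t w =
  gamma ^+ t * \sum_(1 <= s < t.+1) gamma ^- s * (X s w - mu s) * (eps s w)%:R.
Proof.
move=> g0; rewrite /Rsum /Msum -sumrB big_distrr/=.
apply: eq_big_nat => s /andP[_ st].
rewrite exprB ?unitfE//; ring.
Qed.

Lemma Nsum_undiscount (gamma : R) eps t (w : Omega) : gamma != 0 ->
  Nsum gamma eps t w = gamma ^+ t * \sum_(1 <= s < t.+1) gamma ^- s * (eps s w)%:R.
Proof.
move=> g0; rewrite /Nsum big_distrr/=.
apply: eq_big_nat => s /andP[_ st].
rewrite exprB ?unitfE//; ring.
Qed.

Lemma nsum_undiscount (gamma : R) t : gamma != 0 ->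
  gamma ^- t * nsum gamma t = \sum_(1 <= s < t.+1) gamma ^- s.
Proof.
move=> g0; rewrite /nsum big_distrr/=.
apply: eq_big_nat => s /andP[_ st].
by rewrite exprB ?unitfE// mulKf// expf_neq0.
Qed.

Lemma measurable_sum_from1 X t : (forall s, measurable_fun setT (X s.+1)) ->
  measurable_fun setT (fun w => \sum_(1 <= s < t.+1) X s w).
Proof.
move=> mX.
rewrite (_ : (fun w => _) = fun w => \sum_(0 <= s < t) X s.+1 w); last first.
  by apply/funext => w; rewrite big_add1.
exact: measurable_sum.
Qed.

End discounted_sums.

(** * Exponential weights *)

Section exponential_weights.
Context {d : measure_display} {Omega : measurableType d} {R : realType}.
Implicit Types (X : nat -> Omega -> R) (eps : nat -> Omega -> bool) (mu : nat -> R).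

(** The subtracted square is the compensator of Hoeffding's lemma, chosen to keep the mean of the
    weight at most 1 when [mu s] is the mean of [X s]. *)
Definition exp_weight (B : R) (a mu : nat -> R) X (s : nat) (w : Omega) : R :=
  expR (a s * (X s w - mu s) - (a s * B) ^+ 2 / 8).

(** The tilt [lam * gamma ^- s] enters the linear term once and the compensator squared, which is
    how [gamma ^+ 2] arises in the second sum. *)
Lemma pprod_exp_weight (B lam gamma : R) mu X eps t w :
  pprod (exp_weight B (fun s => lam * gamma ^- s) mu X) eps t w =
  expR (lam * (\sum_(1 <= s < t.+1) gamma ^- s * (X s w - mu s) * (eps s w)%:R)
    - (lam * B) ^+ 2 / 8 *
      \sum_(1 <= s < t.+1) (gamma ^+ 2) ^- s * (eps s w)%:R).
Proof.
elim: t => [|t IH].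
  by rewrite pprod0 !big_geq// !mulr0 subrr expR0.
rewrite pprodS IH !(big_nat_recr t.+1)//= /exp_weight.
case: (eps _ _) => /=; last by rewrite !mulr0 !addr0 mulr1.
rewrite -expRD !mulr1; congr expR.
rewrite -!exprVn exprVn -exprM mulnC exprM -!exprVn; ring.
Qed.

End exponential_weights.

(** * Slicing the range of the variance sum and the union bound *)

Unset Implicit Arguments.

Theorem theorem5 (d : measure_display) (Omega : measurableType d) (R : realType)
  (P : probability Omega R) (B : R) (X : nat -> Omega -> R)
  (F : nat -> set (set Omega)) (eps : nat -> Omega -> bool)
  (gamma : R) (T : nat) (delta eta : R) :
  0 < B ->
  (forall t, (0 < t)%N -> measurable_fun setT (X t)) ->
  (forall t, (0 < t)%N -> {ae P, forall w, 0 <= X t w <= B}) ->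
  mutually_independent P X ->
  filtration F ->
  (forall s t, (0 < s)%N -> (s <= t)%N -> measurable_wrt (F t) (X s)) ->
  (forall s t, (t < s)%N -> indep_of_sigma P (X s) (F t)) ->
  (forall t, (0 < t)%N -> F t.-1 [set w | eps t w]) ->
  0 < gamma <= 1 -> (0 < T)%N -> (gamma = 1 -> (2 <= T)%N) ->
  0 < delta -> 0 < eta ->
  let mu := fun t => fine ('E_P[X t])%E in
  (P [set w | exists t, [/\ (1 <= t <= T)%N, 0 < Nsum (gamma ^+ 2) eps t w &
        (Rsum gamma X eps t w - Msum gamma mu eps t w)
          / Num.sqrt (Nsum (gamma ^+ 2) eps t w) > delta]]
   <= ((Num.ceil (ln (gamma ^- (2 * T) * nsum (gamma ^+ 2) T) / ln (1 + eta)))%:~R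
       * expR (- (2 * delta ^+ 2 / B ^+ 2) * (1 - eta ^+ 2 / 16)))%:E)%O.
Proof.
move=> B0 mX XB _ FF FX indX Feps0 /andP[g0 g1] T0 T2 d0 eta0; cbv zeta.
set mu := fun t : nat => fine ('E_P[X t])%E.
have [sF Fm Fh] := FF.
have Feps : predictable F eps by move=> t; exact: (Feps0 t.+1).
have gN0 : gamma != 0 by rewrite gt_eqF.
have g2N0 : gamma ^+ 2 != 0 by rewrite expf_neq0.
have g20 : 0 < gamma ^+ 2 by rewrite exprn_gt0.
pose S t w := \sum_(1 <= s < t.+1) gamma ^- s * (X s w - mu s) * (eps s w)%:R.
pose V t w : R := \sum_(1 <= s < t.+1) (gamma ^+ 2) ^- s * (eps s w)%:R.
pose W : R := \sum_(1 <= s < T.+1) (gamma ^+ 2) ^- s.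
have ge1 s : 1 <= (gamma ^+ 2) ^- s.
  by rewrite invf_ge1 ?exprn_gt0// exprn_ile1// ?exprn_ge0 ?exprn_ile1// ltW.
have gt0 s : 0 <= (gamma ^+ 2) ^- s by exact: le_trans (ge1 s).
have WE : gamma ^- (2 * T) * nsum (gamma ^+ 2) T = W.
  by rewrite exprM nsum_undiscount.
(* If [T = 1] the sum is [gamma ^- 2], which exceeds 1 because [gamma = 1] would force [T >= 2]. If
   [T >= 2] it has at least two terms, each at least 1. *)
have W1 : 1 < W.
  rewrite /W; move: (T) T0 T2 => [//|[_ T2|m _ _]].
    rewrite big_nat1 expr1 invf_gt1// exprn_ilt1 ?ltW// lt_neqAle g1 andbT.
    by apply/eqP => /T2.
  rewrite big_nat_recr//= big_nat_recr//= -addrA.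
  have : 0 <= \sum_(1 <= i < m.+1) (gamma ^+ 2) ^- i by exact: sumr_ge0.
  have := ge1 m.+1; have := ge1 m.+2.
  by move: (\sum_(_ <= _ < _) _) (_ ^- m.+1) (_ ^- m.+2) => x y z *; lra.
have eta1 : 1 < 1 + eta by rewrite ltrDl.
have [n n0 [nE Wn]] := ceil_log_ge eta1 W1.
rewrite WE nE.
set c := 2 * delta ^+ 2 / B ^+ 2 * (1 - eta ^+ 2 / 16).
rewrite (_ : - _ * _ = - c); last by rewrite /c mulNr.
(* The fourth root of [1 + eta]: on a slice, [sqrt V] stays within a factor [q] of the midpoint
   [q^(2k+1)]. *)
pose q := Num.sqrt (Num.sqrt (1 + eta)).
have q4 : q ^+ 4 = 1 + eta.
  by rewrite (exprM q 2 2) sqr_sqrtr ?sqrtr_ge0// sqr_sqrtr// addr_ge0// ltW.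
have q0 : 0 <= q by exact: sqrtr_ge0.
have q1 : 1 <= q by rewrite -(@expr_ge1 _ 4)// q4 ltW.
(* Bernoulli's inequality, [1 + eta <= (1 + eta/4)^4]; squaring [eta / 4] yields the constant 16. *)
have qeta : q <= 1 + eta / 4.
  have e4 : 0 <= 1 + eta / 4 by rewrite addr_ge0// divr_ge0// ltW.
  rewrite -(@ler_pXn2r _ 4)// q4.
  by nra.
have qp : 0 < q by exact: lt_le_trans q1.
(* With [y = q^(2k+1)], this maximizes [lam delta y - lam^2 B^2 y^2 / 8], the exponent at the
   boundary [S = delta y], [V = y^2]. *)
pose lam k := 4 * delta / (B ^+ 2 * q ^+ (2 * k + 1)).
pose Y k := exp_weight B (fun s => lam k * gamma ^- s) mu X.
have FY k s : (0 < s)%N -> measurable_wrt (F s) (Y k s).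
  move=> s0; apply/measurable_wrtP => //.
  apply: measurableT_comp => //; apply: measurable_funB => //.
  apply: measurable_funM => //; apply: measurable_funB => //.
  by apply/measurable_wrtP => //; exact: FX.
have indY k s : indep_of_sigma P (Y k s.+1) (F s).
  move=> A A' FA mA'.
  (* The weight is a Borel function of [X s.+1] alone and so inherits its independence from
     [F s]. *)
  pose h x := expR (lam k * gamma ^- s.+1 * (x - mu s.+1) -
    (lam k * gamma ^- s.+1 * B) ^+ 2 / 8).
  have mh : measurable_fun setT h.
    apply: measurableT_comp => //; apply: measurable_funB => //.
    by apply: measurable_funM => //; exact: measurable_funB.
  have -> : Y k s.+1 @^-1` A' = X s.+1 @^-1` (h @^-1` A') by [].
  by apply: (indX s.+1 s (ltnSn s)) => //; rewrite -[_ @^-1` _]setTI; exact: mh.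
have Y0 k s w : 0 <= Y k s w by exact: expR_ge0.
have EY k s : (0 < s)%N -> (\int[P]_w (Y k s w)%:E <= 1)%E.
  move=> s0; apply: hoeffding_mgf => //; [|exact: mX|exact: XB].
  by rewrite mulr_ge0// ?invr_ge0 ?exprn_ge0 ?(ltW g0)//
     divr_ge0 ?mulr_ge0 ?exprn_ge0// ltW.
pose G k := \bigcup_(t in `I_T.+1) [set w | expR c <= pprod (Y k) eps t w].
have mG k : measurable (G k).
  apply: bigcup_measurable => t _.
  rewrite (_ : [set w | _] = pprod (Y k) eps t @^-1` `[expR c, +oo[); last first.
    by apply/seteqP; split => w /=; rewrite in_itv/= andbT.
  by apply: (Fm t); exact: (pprod_adapted t FF (FY k) Feps).
have PG k : (P (G k) <= (expR (- c))%:E)%E.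
  rewrite expRN; apply: (pprod_maximal T FF (FY k) (indY k) (Y0 k) (EY k) Feps).
  exact: expR_gt0.
set E := [set w | _].
(* The factor [gamma^t] of the numerator cancels the square root of [gamma^(2t)]. *)
have ratioE t w : (Rsum gamma X eps t w - Msum gamma mu eps t w)
    / Num.sqrt (Nsum (gamma ^+ 2) eps t w) = S t w / Num.sqrt (V t w).
  rewrite Rsum_undiscount// Nsum_undiscount// -exprM mulnC exprM sqrtrM ?sqr_ge0//.
  rewrite sqrtr_sqr ger0_norm ?exprn_ge0 ?(ltW g0)//.
  by rewrite invfM mulrACA divff ?mul1r// expf_neq0.
have NE t w : (0 < Nsum (gamma ^+ 2) eps t w) = (0 < V t w).
  by rewrite Nsum_undiscount// pmulr_rgt0// exprn_gt0.
have meps s : measurable_fun setT (fun w => (eps s.+1 w)%:R : R).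
  rewrite (_ : (fun w => _) = \1_[set w | eps s.+1 w]).
    by apply: measurable_indic; apply: (Fm s); exact: Feps.
  apply/funext => w; rewrite indicE; congr ((nat_of_bool _)%:R).
  by apply/idP/idP; rewrite inE.
have mS t : measurable_fun setT (S t).
  apply: measurable_sum_from1 => s; apply: measurable_funM => //.
  by apply: measurable_funM => //; apply: measurable_funB => //; exact: mX.
have mV t : measurable_fun setT (V t).
  by apply: measurable_sum_from1 => s; exact: measurable_funM.
have mE : measurable E.
  (* Clearing the square root, positive where [V] is, exhibits [E] as a union over times of
     preimages under measurable functions. *)
  rewrite (_ : E = \bigcup_(t in [set t | (1 <= t <= T)%N])
      ((V t @^-1` `]0, +oo[) `&`
       ((fun w => S t w - delta * Num.sqrt (V t w)) @^-1` `]0, +oo[))).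
    apply: bigcup_measurable => t _; apply: measurableI.
      by rewrite -[_ @^-1` _]setTI; exact: mV.
    rewrite -[_ @^-1` _]setTI; apply: measurable_funB => //.
    apply: measurable_funM => //; apply: measurableT_comp => //.
    by apply: continuous_measurable_fun; exact: sqrt_continuous.
  apply/seteqP; split => w.
    move=> [t []]; rewrite NE ratioE => tT V0 dS; exists t => //=.
    by rewrite !in_itv/= !andbT V0 subr_gt0 -ltr_pdivlMr// sqrtr_gt0.
  move=> [t /= tT]; rewrite !in_itv/= !andbT => -[V0].
  rewrite subr_gt0 -ltr_pdivlMr ?sqrtr_gt0// => dS.
  by exists t; rewrite NE ratioE.
have EG : E `<=` \big[setU/set0]_(k < n) G k.
  move=> w [t []]; rewrite NE ratioE => /andP[t1 tT] V0 dS.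
  (* A positive [V] has some [eps s] on, and that term alone is at least 1. *)
  have V1 : 1 <= V t w.
    have [s /andP[s0 st] es] : exists2 s, (1 <= s < t.+1)%N & eps s w.
      apply: contrapT => H; move: V0; rewrite /V big_nat big1 ?ltxx// => s st.
      by case: (boolP (eps s w)) => [es|]; [case: H; exists s | rewrite mulr0].
    rewrite /V (bigD1_seq s) ?mem_index_iota ?s0 ?iota_uniq//= es mulr1.
    rewrite (le_trans (ge1 s))// lerDl sumr_ge0// => i _.
    by rewrite mulr_ge0// ler0n.
  have VW : V t w <= (1 + eta) ^+ n.
    apply: le_trans Wn; rewrite /V /W [leRHS](@big_cat_nat _ _ _ t.+1)//=.
    rewrite -[leLHS]addr0 lerD ?sumr_ge0//.
    by apply: ler_sum => s _; case: (eps s w); rewrite ?mulr1 ?mulr0.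
  have [k kn Vk] := geometric_slice V1 VW n0.
  rewrite -bigcup_mkord; exists k => //; exists t; first exact: leq_ltn_trans tT _.
  rewrite /= pprod_exp_weight ler_expR.
  apply: (@tilted_exponent_ge _ B delta eta q) => //.
    by rewrite exprn_gt0.
  (* In powers of [q] the slice is [q^(4k) <= V <= q^(4k+4)], that is, from [(y / q)^2] to [(y q)^2]
     with [y = q^(2k+1)]. *)
  move: Vk; rewrite -q4 -!exprM => /andP[Vl Vu].
  rewrite addn1 [X in X / q](exprSr q) mulfK ?gt_eqF// -(exprSr q) -!exprM.
  rewrite (_ : 2 * k * 2 = 4 * k)%N; last by rewrite mulnAC.
  rewrite (_ : (2 * k).+2 * 2 = 4 * k.+1)%N ?Vl//.
  by rewrite mulnC mulnSr mulnSr [RHS]mulnSr mulnA -addnA.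
(* Union bound over the [n] slices, each of probability at most [exp (- c)]. *)
apply: (@le_trans _ _ (\sum_(k < n) P (G k))%E).
  by apply: content_subadditive => // k _; exact: mG.
apply: (@le_trans _ _ (\sum_(k < n) (expR (- c))%:E)%E).
  by apply: lee_sum => k _; exact: PG.
by rewrite sumEFin lee_fin sumr_const card_ord mulr_natl.
Qed.
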